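(* An extension $\mathcal{L}$ of $\mathrm{BD}_\infty$ which satisfies either the weak CP or the weak PCP is selfextensional if and only if $\mathcal{L}$ lies in one of the (pairwise disjoint) intervals $[\mathrm{BD}_\infty,\mathrm{BD}_1]$, $[\mathrm{KO}_\infty,\mathrm{KO}_1]$, $[\mathrm{CL}_\infty\cap\mathrm{TRIV}_-,\mathrm{CL}_1]$, or in $\{\mathrm{TRIV}_-,\mathrm{TRIV}\}$.
   Context: Formulas are built from variables using $\wedge,\vee,\neg$. A structure is a pair $\langle\mathbf{A},F\rangle$, $F\subseteq A$; a rule $\Gamma\vdash\varphi$ is valid in it if every homomorphism $v$ from the formula algebra with $v[\Gamma]\subseteq F$ has $v(\varphi)\in F$. A logic is a substitution-invariant consequence relation; logics are ordered by inclusion of consequence relations, $[\mathcal{L}_1,\mathcal{L}_2]$ denotes an interval in this order, $\cap$ is intersection; the extension by rules is the smallest logic containing the given one and the rules. $\mathrm{BD}_\infty$: logic of all $\langle\mathbf{A},F\rangle$ with $\mathbf{A}$ a De~Morgan lattice (distributive lattice with $\neg$, $\neg\neg x=x$, De~Morgan laws) and $F$ an upset. $\mathrm{LP}_\infty$: extension of $\mathrm{BD}_\infty$ by $\emptyset\vdash x\vee\neg x$ and $x\vdash x\wedge(y\vee\neg y)$; $\mathrm{K}_\infty$: by $(x\wedge\neg x)\vee y\vdash y$; $\mathrm{CL}_\infty$: by all three; $\mathrm{KO}_\infty$: by $((x\wedge\neg x)\wedge z)\vee u\vdash((y\vee\neg y)\wedge z)\vee u$. $\mathrm{BD}_1,\mathrm{KO}_1,\mathrm{CL}_1$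 are the extensions of $\mathrm{BD}_\infty,\mathrm{KO}_\infty,\mathrm{CL}_\infty$ by adjunction $x,y\vdash x\wedge y$. $\mathrm{TRIV}$: $\Gamma\vdash\varphi$ always; $\mathrm{TRIV}_-$: $\Gamma\vdash\varphi$ iff $\Gamma\ne\emptyset$. Weak PCP: $\varphi_1\vdash_{\mathcal{L}}\psi$ and $\varphi_2\vdash_{\mathcal{L}}\psi$ imply $\varphi_1\vee\varphi_2\vdash_{\mathcal{L}}\psi$. Weak CP: $\varphi\vdash_{\mathcal{L}}\psi_1$ and $\varphi\vdash_{\mathcal{L}}\psi_2$ imply $\varphi\vdash_{\mathcal{L}}\psi_1\wedge\psi_2$. $\mathcal{L}$ is selfextensional if interderivability in $\mathcal{L}$ is a congruence on the formula algebra. *)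

(* Defs.v *)
From mathcomp Require Import all_boot all_order.
From mathcomp Require Import boolp classical_sets.

Set Implicit Arguments.
Unset Strict Implicit.
Unset Printing Implicit Defensive.

Local Open Scope classical_set_scope.

(** ** Algebras in the signature of conjunction, disjunction and negation *)

Record algebra := Algebra {
  carrier :> Type;
  aand : carrier -> carrier -> carrier;
  aor : carrier -> carrier -> carrier;
  aneg : carrier -> carrier
}.

Definition hom (A B : algebra) (v : A -> B) : Prop :=
  [/\ forall x y, v (aand x y) = aand (v x) (v y),
      forall x y, v (aor x y) = aor (v x) (v y)
    & forall x, v (aneg x) = aneg (v x)].

Definition congruence (A : algebra) (R : A -> A -> Prop) : Prop :=
  [/\ forall x, R x x,
      forall x y, R x y -> R y x
    & forall x y z, R x y -> R y z -> R x z] /\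
  [/\ forall x x' y y', R x x' -> R y y' -> R (aand x y) (aand x' y'),
      forall x x' y y', R x x' -> R y y' -> R (aor x y) (aor x' y')
    & forall x x', R x x' -> R (aneg x) (aneg x')].

Inductive formula : Type :=
  | Var of nat
  | And of formula & formula
  | Or of formula & formula
  | Neg of formula.

Definition Fm : algebra := Algebra And Or Neg.

(** ** Logics *)

(* Substitutions are the endomorphisms of the formula algebra; premise sets
   are arbitrary, and consequence relations need not be finitary. *)
Record logic := Logic {
  entails :> set formula -> formula -> Prop;
  logic_refl : forall Gamma phi, Gamma phi -> entails Gamma phi;
  logic_mono : forall Gamma Delta phi,
    Gamma `<=` Delta -> entails Gamma phi -> entails Delta phi;
  logic_cut : forall Gamma Delta phi,
    (forall delta, Delta delta -> entails Gamma delta) ->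
    entails (Gamma `|` Delta) phi -> entails Gamma phi;
  logic_subst : forall (s : Fm -> Fm) Gamma phi,
    hom s -> entails Gamma phi -> entails (s @` Gamma) (s phi)
}.

Definition logic_le (L1 L2 : logic) : Prop :=
  forall Gamma phi, L1 Gamma phi -> L2 Gamma phi.

Definition logic_eq (L1 L2 : logic) : Prop :=
  forall Gamma phi, L1 Gamma phi <-> L2 Gamma phi.

Definition interval (L1 L2 : logic) : set logic :=
  [set L | logic_le L1 L /\ logic_le L L2].

Definition interderivable (L : logic) (phi psi : formula) : Prop :=
  L [set phi] psi /\ L [set psi] phi.

Definition selfextensional (L : logic) : Prop :=
  @congruence Fm (interderivable L).

Definition weak_PCP (L : logic) : Prop := forall phi1 phi2 psi,
  L [set phi1] psi -> L [set phi2] psi -> L [set Or phi1 phi2] psi.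

Definition weak_CP (L : logic) : Prop := forall phi psi1 psi2,
  L [set phi] psi1 -> L [set phi] psi2 -> L [set phi] (And psi1 psi2).

(** ** Logics determined by structures *)

Record structure := Structure {
  str_alg : algebra;
  str_filter : set str_alg
}.

Definition valid (S : structure) (Gamma : set formula) (phi : formula) : Prop :=
  forall v : Fm -> str_alg S, hom v ->
    v @` Gamma `<=` @str_filter S -> @str_filter S (v phi).

Section LogicOf.
Variables (I : Type) (S : I -> structure).

Definition logic_of_ent Gamma phi : Prop := forall i, valid (S i) Gamma phi.

Lemma logic_of_refl Gamma phi : Gamma phi -> logic_of_ent Gamma phi.
Proof. by move=> Gphi i v _ vG; apply: vG; exists phi. Qed.

Lemma logic_of_mono Gamma Delta phi :
  Gamma `<=` Delta -> logic_of_ent Gamma phi -> logic_of_ent Delta phi.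
Proof.
move=> sGD Gphi i v hv vD; apply: Gphi => //.
by move=> _ [g Gg <-]; apply: vD; exists g => //; apply: sGD.
Qed.

Lemma logic_of_cut Gamma Delta phi :
  (forall delta, Delta delta -> logic_of_ent Gamma delta) ->
  logic_of_ent (Gamma `|` Delta) phi -> logic_of_ent Gamma phi.
Proof.
move=> GD GDphi i v hv vG; apply: GDphi => //.
move=> _ [g [Gg|Dg] <-]; first by apply: vG; exists g.
exact: GD.
Qed.

Lemma logic_of_subst (s : Fm -> Fm) Gamma phi :
  hom s -> logic_of_ent Gamma phi -> logic_of_ent (s @` Gamma) (s phi).
Proof.
move=> [sA sO sN] Gphi i v [vA vO vN] vG.
apply: (Gphi i (fun x => v (s x))).
  by split=> *; rewrite ?sA ?sO ?sN ?vA ?vO ?vN.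
by move=> _ [g Gg <-]; apply: vG; exists (s g) => //; exists g.
Qed.

Definition logic_of : logic :=
  Logic logic_of_refl logic_of_mono logic_of_cut logic_of_subst.
End LogicOf.

(** ** Operations on logics *)

Definition rule : Type := (set formula * formula)%type.

Section Extension.
Variables (L : logic) (rules : set rule).

Definition contains_ext (L' : logic) : Prop :=
  logic_le L L' /\ forall r : rule, rules r -> L' r.1 r.2.

Definition extension_ent Gamma phi : Prop :=
  forall L', contains_ext L' -> L' Gamma phi.

Lemma extension_refl Gamma phi : Gamma phi -> extension_ent Gamma phi.
Proof. by move=> Gphi L' _; apply: logic_refl. Qed.

Lemma extension_mono Gamma Delta phi :
  Gamma `<=` Delta -> extension_ent Gamma phi -> extension_ent Delta phi.
Proof. by move=> sGD Gphi L' L'P; apply: logic_mono sGD (Gphi L' L'P). Qed.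

Lemma extension_cut Gamma Delta phi :
  (forall delta, Delta delta -> extension_ent Gamma delta) ->
  extension_ent (Gamma `|` Delta) phi -> extension_ent Gamma phi.
Proof.
move=> GD GDphi L' L'P; apply: logic_cut (GDphi L' L'P) => delta Dd.
exact: GD.
Qed.

Lemma extension_subst (s : Fm -> Fm) Gamma phi :
  hom s -> extension_ent Gamma phi -> extension_ent (s @` Gamma) (s phi).
Proof. by move=> hs Gphi L' L'P; apply: logic_subst (Gphi L' L'P). Qed.

Definition extension : logic :=
  Logic extension_refl extension_mono extension_cut extension_subst.
End Extension.

Lemma extension_contains L rules : contains_ext L rules (extension L rules).
Proof.
split=> [Gamma phi LG L' [LL' _]|r rr L' [_ rL']]; first exact: LL'.
exact: rL'.
Qed.

Lemma extension_smallest L rules L' :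
  contains_ext L rules L' -> logic_le (extension L rules) L'.
Proof. by move=> L'P Gamma phi /(_ L' L'P). Qed.

Section Meet.
Variables L1 L2 : logic.

Definition logic_meet_ent Gamma phi : Prop := L1 Gamma phi /\ L2 Gamma phi.

Lemma logic_meet_refl Gamma phi : Gamma phi -> logic_meet_ent Gamma phi.
Proof. by split; apply: logic_refl. Qed.

Lemma logic_meet_mono Gamma Delta phi :
  Gamma `<=` Delta -> logic_meet_ent Gamma phi -> logic_meet_ent Delta phi.
Proof.
by move=> sGD [G1 G2]; split; [apply: logic_mono G1|apply: logic_mono G2].
Qed.

Lemma logic_meet_cut Gamma Delta phi :
  (forall delta, Delta delta -> logic_meet_ent Gamma delta) ->
  logic_meet_ent (Gamma `|` Delta) phi -> logic_meet_ent Gamma phi.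
Proof.
move=> GD [GD1 GD2]; split.
  by apply: logic_cut GD1 => delta /GD[].
by apply: logic_cut GD2 => delta /GD[].
Qed.

Lemma logic_meet_subst (s : Fm -> Fm) Gamma phi :
  hom s -> logic_meet_ent Gamma phi -> logic_meet_ent (s @` Gamma) (s phi).
Proof. by move=> hs [G1 G2]; split; apply: logic_subst. Qed.

Definition logic_meet : logic :=
  Logic logic_meet_refl logic_meet_mono logic_meet_cut logic_meet_subst.
End Meet.

Definition TRIV : logic.
Proof. by refine (@Logic (fun _ _ => True) _ _ _ _). Defined.

Definition TRIVm : logic.
Proof.
refine (@Logic (fun Gamma _ => Gamma !=set0) _ _ _ _).
- by move=> Gamma phi Gphi; exists phi.
- by move=> Gamma Delta phi sGD [g Gg]; exists g; apply: sGD.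
- by move=> Gamma Delta phi GD [g [Gg|Dg]]; [exists g|exact: (GD g)].
- by move=> s Gamma phi _ [g Gg]; exists (s g); exists g.
Defined.

(** ** De Morgan lattices and the logics of the theorem *)

Record deMorganLattice := DeMorganLattice {
  dm_disp : Order.disp_t;
  dm_lattice :> distrLatticeType dm_disp;
  dm_neg : dm_lattice -> dm_lattice;
  dm_negK : forall x, dm_neg (dm_neg x) = x;
  dm_negI : forall x y, dm_neg (x `&` y)%O = (dm_neg x `|` dm_neg y)%O;
  dm_negU : forall x y, dm_neg (x `|` y)%O = (dm_neg x `&` dm_neg y)%O
}.

Definition dm_algebra (A : deMorganLattice) : algebra :=
  Algebra (@Order.meet _ A) (@Order.join _ A) (@dm_neg A).

(* The upset may be empty. *)
Record dm_upset := DmUpset {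
  du_lattice : deMorganLattice;
  du_upset : set du_lattice;
  du_upsetP : forall x y : du_lattice, (x <= y)%O -> du_upset x -> du_upset y
}.

Definition dm_structure (U : dm_upset) : structure :=
  @Structure (dm_algebra (du_lattice U)) (@du_upset U).

Definition BD_inf : logic := logic_of dm_structure.

Local Notation x := (Var 0).
Local Notation y := (Var 1).
Local Notation z := (Var 2).
Local Notation u := (Var 3).

Definition lem_rule : rule := (set0, Or x (Neg x)).
Definition lem_weakening_rule : rule := ([set x], And x (Or y (Neg y))).
Definition K_rule : rule := ([set Or (And x (Neg x)) y], y).
Definition KO_rule : rule :=
  ([set Or (And (And x (Neg x)) z) u], Or (And (Or y (Neg y)) z) u).
Definition adjunction : rule := ([set x; y], And x y).

Definition KO_inf : logic := extension BD_inf [set KO_rule].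
Definition CL_inf : logic :=
  extension BD_inf [set lem_rule; lem_weakening_rule; K_rule].

Definition BD_1 : logic := extension BD_inf [set adjunction].
Definition KO_1 : logic := extension KO_inf [set adjunction].
Definition CL_1 : logic := extension CL_inf [set adjunction].

(* Main.v *)
Require Import Defs.
From mathcomp Require Import all_boot all_order.
From mathcomp Require Import boolp classical_sets.

Local Open Scope classical_set_scope.

Import Order.Theory.

(** A prime theory assigns to every formula one of the four values true, false,
    glut (both) and gap (neither), and by Zorn's lemma single-premise
    consequence in [BD_inf], [KO_inf] and [CL_inf] is preservation of all prime
    theories, of those without gluts or without gaps, and of those with
    neither, respectively. These classes are closed under the duality
    T |-> {a | Neg a not in T}, hence the logics in the intervals are
    selfextensional.

    Conversely, weak CP or weak PCP makes entailment in a selfextensional L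
    definable from interderivability, so it is monotone in conjunction and
    disjunction and antitone in negation. Suppose L proves G |- f although some
    prime theory T contains G but not f. Replacing each variable by a literal
    that depends only on its value in T gives, in L,
    y, x, Neg x |- Neg y, z, Neg z (premises conjoined, conclusions disjoined),
    where x and Neg x are needed only if T has gluts and z and Neg z only if it
    has gaps. Depending on these two cases, this yields x /\ ~x |- y \/ ~y,
    x /\ ~x |- y or x |- y, so whether L has each of these three rules
    determines its interval. *)

(** * Prime theories as bivaluations *)

(* The prime theories, closed under the De Morgan laws; both the empty set and
   the set of all formulas are allowed. *)
Record bivaluation (T : set formula) : Prop := Bivaluation {
  bivalA : forall a b, T (And a b) = (T a /\ T b);
  bivalO : forall a b, T (Or a b) = (T a \/ T b);
  bivalNN : forall a, T (Neg (Neg a)) = T a;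
  bivalNA : forall a b, T (Neg (And a b)) = (T (Neg a) \/ T (Neg b));
  bivalNO : forall a b, T (Neg (Or a b)) = (T (Neg a) /\ T (Neg b))
}.

Lemma bivaluation_subst (T : set formula) (s : Fm -> Fm) :
  hom s -> bivaluation T -> bivaluation [set a | T (s a)].
Proof.
move=> [sA sO sN] [TA TO TNN TNA TNO].
have {}sA a b : s (And a b) = And (s a) (s b) by exact: sA.
have {}sO a b : s (Or a b) = Or (s a) (s b) by exact: sO.
have {}sN a : s (Neg a) = Neg (s a) by exact: sN.
by split=> *; rewrite /mkset ?(sN, sA, sO, TNN, TNA, TNO, TA, TO).
Qed.

(** The clauses reduce [a] and [Neg a] monotonically to literals, so the induction carries both at
    once. *)
Lemma bivaluation_le (T U : set formula) :
    bivaluation T -> bivaluation U ->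
    (forall i, T (Var i) -> U (Var i)) ->
    (forall i, T (Neg (Var i)) -> U (Neg (Var i))) ->
  T `<=` U.
Proof.
move=> [TA TO TNN TNA TNO] [UA UO UNN UNA UNO] leV leNV a.
suff [] : (T a -> U a) /\ (T (Neg a) -> U (Neg a)) by [].
elim: a => [i|a [? ?] b [? ?]|a [? ?] b [? ?]|a [? ?]];
  rewrite ?(TA, TO, TNN, TNA, TNO, UA, UO, UNN, UNA, UNO); last 3 first; try tauto.
by split; [apply: leV|apply: leNV].
Qed.

(** The Routley star of [T]; it exchanges gluts and gaps. *)
Definition dual_theory (T : set formula) : set formula := [set a | ~ T (Neg a)].

Lemma bivaluation_dual (T : set formula) :
  bivaluation T -> bivaluation (dual_theory T).
Proof.
move=> [TA TO TNN TNA TNO]; rewrite /dual_theory.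
split=> *; rewrite /mkset ?(TNN, TA, TO, TNA, TNO) ?not_orE ?not_andE //.
Qed.

Definition four : distrLatticeType _ :=
  [the distrLatticeType _ of (bool *p bool)%type].

(** The coordinates mean told true and not told false. The product order is then the truth order,
    and negation fixes the glut (true, false) and the gap (false, true). *)
Definition four_neg (a : four) : four := (~~ a.2, ~~ a.1).

Lemma four_negK a : four_neg (four_neg a) = a.
Proof. by case: a => [[] []]. Qed.

Lemma four_negI a b : four_neg (a `&` b)%O = (four_neg a `|` four_neg b)%O.
Proof. by case: a b => [[] []] [[] []]. Qed.

Lemma four_negU a b : four_neg (a `|` b)%O = (four_neg a `&` four_neg b)%O.
Proof. by case: a b => [[] []] [[] []]. Qed.

Definition four_deMorgan := DeMorganLattice four_negK four_negI four_negU.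

Lemma four_upsetP (a b : four_deMorgan) : (a <= b)%O -> a.1 -> b.1.
Proof. by case: a b => [[] []] [[] []]. Qed.

Definition four_upset : dm_upset :=
  @DmUpset four_deMorgan (fun a => a.1) four_upsetP.

Lemma BD_sound (T : set formula) (G : set formula) f :
  bivaluation T -> BD_inf G f -> G `<=` T -> T f.
Proof.
move=> [TA TO TNN TNA TNO] /(_ four_upset) BDGf sGT.
pose v (a : Fm) : str_alg (dm_structure four_upset) :=
  (`[< T a >], ~~ `[< T (Neg a) >]).
have: du_upset (v f).
  apply: BDGf => [|_ [g Gg <-]]; last by apply/asboolP; exact: sGT.
  split=> [a b|a b|a]; rewrite /v /=.
  - by rewrite TA TNA asbool_and asbool_or negb_or.
  - by rewrite TO TNO asbool_and asbool_or negb_and.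
  - by rewrite TNN /four_neg /= negbK.
by move=> /asboolP.
Qed.

Lemma entails_cut1 (L : logic) G a b : L G a -> L [set a] b -> L G b.
Proof.
move=> LGa Lab; apply: (@logic_cut L _ [set a]) => [_ ->//|].
by apply: logic_mono Lab => ? ->; right.
Qed.

Lemma entails1_trans (L : logic) a b c :
  L [set a] b -> L [set b] c -> L [set a] c.
Proof. exact: entails_cut1. Qed.

Lemma BD_of_le a b :
  (forall (A : deMorganLattice) (v : Fm -> dm_algebra A), hom v ->
     (v a <= v b :> A)%O) -> BD_inf [set a] b.
Proof.
move=> leab [A F upF] v hv vF /=; apply: (upF (v a)); first exact: leab.
by apply: vF; exists a.
Qed.

Lemma le_of_BD a b (A : deMorganLattice) (v : Fm -> dm_algebra A) :
  hom v -> BD_inf [set a] b -> (v a <= v b :> A)%O.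
Proof.
move=> hv BDab.
(* The principal upset of [v a] serves as the filter. *)
have upP (x y : A) : (x <= y)%O -> (v a <= x)%O -> (v a <= y)%O.
  by move=> xy ax; apply: le_trans xy.
apply: (BDab (@DmUpset A (fun x => v a <= x)%O upP)) => //.
by move=> _ [_ -> <-] /=.
Qed.

(** * Existence of prime theories and completeness of [BD_inf] *)

Section PrimeTheory.
Variable R : formula -> formula -> Prop.
Hypothesis R_BD : forall a b, BD_inf [set a] b -> R a b.
Hypothesis R_trans : forall a b c, R a b -> R b c -> R a c.
Hypothesis R_glb : forall a b c, R a b -> R a c -> R a (And b c).
Hypothesis R_lub : forall a b c, R a c -> R b c -> R (Or a b) c.

Definition theory (T : set formula) : Prop :=
  (forall a b, R a b -> T a -> T b) /\ (forall a b, T a -> T b -> T (And a b)).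

Let R_le a b :
  (forall (A : deMorganLattice) (v : Fm -> dm_algebra A), hom v ->
     (v a <= v b :> A)%O) -> R a b.
Proof. by move=> ?; apply/R_BD/BD_of_le. Qed.

Let RAl a b : R (And a b) a.
Proof. by apply: R_le => A v [vA _ _]; rewrite vA leIl. Qed.

Let RAr a b : R (And a b) b.
Proof. by apply: R_le => A v [vA _ _]; rewrite vA leIr. Qed.

Let ROl a b : R a (Or a b).
Proof. by apply: R_le => A v [_ vO _]; rewrite vO leUl. Qed.

Let ROr a b : R b (Or a b).
Proof. by apply: R_le => A v [_ vO _]; rewrite vO leUr. Qed.

Lemma theory_of_adjoin (T : set formula) a :
  theory T -> theory [set b | exists2 t, T t & R (And t a) b].
Proof.
move=> [Tup TA]; split=> [b c Rbc [t Tt Rtb]|b c [t Tt Rtb] [t' Tt' Rtc]].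
  by exists t => //; apply: R_trans Rbc.
exists (And t t'); first exact: TA.
apply: R_glb; [apply: R_trans Rtb|apply: R_trans Rtc]; apply: R_glb => //;
  by apply: R_trans (RAl _ _) _.
Qed.

(** Zorn gives a theory M maximal among those omitting f. If M contained [Or a b] but neither
    disjunct, adjoining either one would yield f, and distributivity would put f into M. [R] is kept
    abstract to cover both [BD_inf] and [context_le]. *)
Lemma prime_theory (T : set formula) f : theory T -> ~ T f ->
  exists T', [/\ bivaluation T', theory T', T `<=` T' & ~ T' f].
Proof.
move=> thT Tf.
(* The empty theory is admitted so that the empty chain has an upper bound. *)
pose P X := [/\ theory X, ~ X f & X !=set0 -> T `<=` X].
have [F FP Ftot|M [[[Mup MA] Mf MT] Mmax]] := @Zorn_bigcup formula P.
  split.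
  - split=> [a b Rab [X FX Xa]|a b [X FX Xa] [Y FY Yb]].
      by exists X => //; have [[Xup _] _ _] := FP _ FX; apply: Xup Xa.
    have [XY|YX] := Ftot _ _ FX FY.
      by exists Y => //; have [[_ YA] _ _] := FP _ FY; apply: YA => //; apply: XY.
    by exists X => //; have [[_ XA] _ _] := FP _ FX; apply: XA => //; apply: YX.
  - by move=> [X FX Xf]; have [_ /(_ Xf)] := FP _ FX.
  - move=> [a [X FX Xa]] b Tb; exists X => //.
    by have [_ _ XT] := FP _ FX; apply: XT => //; exists a.
(* A nonempty M contains T by [P]; an empty one would be properly extended by T. *)
have sTM : T `<=` M.
  move=> a Ta; apply: contrapT => Ma.
  have M0 b : ~ M b by move=> Mb; apply: Ma; apply: MT => //; exists b.
  apply: (Mmax T); last by split=> // _ b.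
  by split=> [b /M0//|sTM]; apply/Ma/sTM.
have thM : theory M by [].
have adjoin a t : M t -> ~ M a -> exists2 t', M t' & R (And t' a) f.
  move=> Mt Ma; apply: contrapT => nf.
  have sub : M `<=` [set b | exists2 t0, M t0 & R (And t0 a) b].
    by move=> b Mb; exists b => //; exact: RAl.
  apply: (Mmax [set b | exists2 t', M t' & R (And t' a) b]).
    by split=> // sM; apply/Ma/sM; exists t => //; exact: RAr.
  by split=> //; [exact: theory_of_adjoin|move=> _ b /sTM /sub].
exists M; split=> //.
have DMl a b : R (Neg (And a b)) (Or (Neg a) (Neg b)).
  by apply: R_le => A v [vA vO vN]; rewrite vO !vN vA /= dm_negI.
have DMr a b : R (Or (Neg a) (Neg b)) (Neg (And a b)).
  by apply: R_le => A v [vA vO vN]; rewrite vO !vN vA /= dm_negI.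
have DMl' a b : R (Neg (Or a b)) (And (Neg a) (Neg b)).
  by apply: R_le => A v [vA vO vN]; rewrite vA !vN vO /= dm_negU.
have DMr' a b : R (And (Neg a) (Neg b)) (Neg (Or a b)).
  by apply: R_le => A v [vA vO vN]; rewrite vA !vN vO /= dm_negU.
have MAE a b : M (And a b) = (M a /\ M b).
  apply/propext; split=> [Mab|[]]; last exact: MA.
  by split; apply: Mup Mab.
have MOE a b : M (Or a b) = (M a \/ M b).
  apply/propext; split=> [Mab|[]]; try by apply: Mup.
  apply: contrapT => /not_orP[Ma Mb].
  have [t Mt Rt] := adjoin a _ Mab Ma; have [t' Mt' Rt'] := adjoin b _ Mab Mb.
  apply/Mf/(Mup (And (And t t') (Or a b))); last by rewrite !MAE.
  apply: R_trans (R_lub _ _ _ Rt Rt'); apply: R_le => A v [vA vO vN].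
  rewrite !(vA, vO) /= meetUr leU2 // leI2 //; [exact: leIl|exact: leIr].
split=> // [a|a b|a b].
- apply/propext; split; apply: Mup; apply: R_le => A v [vA vO vN];
    by rewrite !vN /= dm_negK.
- by rewrite -MOE; apply/propext; split; apply: Mup.
- by rewrite -MAE; apply/propext; split; apply: Mup.
Qed.
End PrimeTheory.

Definition bival_le a b := forall T : set formula, bivaluation T -> T a -> T b.

Lemma BD_complete a b : bival_le a b -> BD_inf [set a] b.
Proof.
move=> leab; apply: contrapT => nab.
pose R c d := BD_inf [set c] d.
have R_trans c d e : R c d -> R d e -> R c e by exact: entails1_trans.
have R_glb c d e : R c d -> R c e -> R c (And d e).
  move=> Rcd Rce; apply: BD_of_le => A v hv; have [vA _ _] := hv.
  by rewrite vA lexI !le_of_BD.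
have R_lub c d e : R c e -> R d e -> R (Or c d) e.
  move=> Rce Rde; apply: BD_of_le => A v hv; have [_ vO _] := hv.
  by rewrite vO leUx !le_of_BD.
have thT : theory R [set c | R a c].
  by split=> [c d Rcd Rac|c d]; [apply: R_trans Rcd|apply: R_glb].
have [T [bT _ aT bnT]] := prime_theory R (fun _ _ => id) R_trans R_glb R_lub
  _ b thT nab.
have Ta : T a by apply: aT; exact: logic_refl.
exact: bnT (leab _ bT Ta).
Qed.

Ltac bival := apply: BD_complete;
  let T := fresh "T" in let bT := fresh "bT" in move=> T bT;
  rewrite ?(bivalNN _ bT, bivalNA _ bT, bivalNO _ bT, bivalA _ bT, bivalO _ bT); tauto.

(** * Extensions of [BD_inf] *)

Fixpoint subst (s : nat -> formula) (a : formula) : formula :=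
  match a with
  | Var i => s i
  | And b c => And (subst s b) (subst s c)
  | Or b c => Or (subst s b) (subst s c)
  | Neg b => Neg (subst s b)
  end.

Lemma subst_hom s : @hom Fm Fm (subst s).
Proof. by []. Qed.

Lemma entails1_subst (L : logic) s a b :
  L [set a] b -> L [set subst s a] (subst s b).
Proof. by move=> /(logic_subst (subst_hom s)); rewrite image_set1. Qed.

Definition assign (a b c d : formula) (i : nat) : formula :=
  match i with 0 => a | 1 => b | 2 => c | _ => d end.

Section Context.
Variable L : logic.
Hypothesis BDL : logic_le BD_inf L.

(** Unlike single-premise entailment in an arbitrary extension, this relation respects meets and
    joins, as [prime_theory] requires. [KO_rule] is an instance of it. *)
Definition context_le a b : Prop :=
  forall c d, L [set Or (And a c) d] (Or (And b c) d).

Lemma context_le_entails a b : context_le a b -> L [set a] b.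
Proof.
(* In this context the premise is equivalent to a and the conclusion to [And a b]. *)
move=> /(_ a (And a b)) Lab.
apply: (@entails1_trans _ _ (Or (And a a) (And a b))); first by apply: BDL; bival.
by apply: entails1_trans Lab _; apply: BDL; bival.
Qed.

Lemma context_le_BD a b : BD_inf [set a] b -> context_le a b.
Proof.
move=> BDab c d; apply/BDL/BD_complete => T bT.
rewrite !(bivalO _ bT) !(bivalA _ bT) => -[[Ta Tc]|]; last by right.
by left; split=> //; apply: (BD_sound _ _ _ bT BDab) => _ ->.
Qed.

Lemma context_le_trans a b c : context_le a b -> context_le b c -> context_le a c.
Proof. by move=> Lab Lbc d e; apply: entails1_trans (Lab d e) (Lbc d e). Qed.

(** Duplicate a and replace one copy at a time, counting the other as part of the context. *)
Lemma context_le_glb a b c :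
  context_le a b -> context_le a c -> context_le a (And b c).
Proof.
move=> Lab Lac d e.
apply: (@entails1_trans _ _ (Or (And a (And a d)) e)); first by apply: BDL; bival.
apply: entails1_trans (Lab _ _) _.
apply: (@entails1_trans _ _ (Or (And a (And b d)) e)); first by apply: BDL; bival.
by apply: entails1_trans (Lac _ _) _; apply: BDL; bival.
Qed.

Lemma context_le_lub a b c :
  context_le a c -> context_le b c -> context_le (Or a b) c.
Proof.
move=> Lac Lbc d e.
apply: (@entails1_trans _ _ (Or (And a d) (Or (And b d) e))).
  by apply: BDL; bival.
apply: entails1_trans (Lac _ _) _.
apply: (@entails1_trans _ _ (Or (And b d) (Or (And c d) e))).
  by apply: BDL; bival.
by apply: entails1_trans (Lbc _ _) _; apply: BDL; bival.
Qed.

Lemma context_prime_theory (T : set formula) f :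
    (forall a b, L [set a] b -> T a -> T b) ->
    (forall a b, T a -> T b -> T (And a b)) -> ~ T f ->
  exists T', [/\ bivaluation T', T `<=` T', ~ T' f &
    forall a b, context_le a b -> T' a -> T' b].
Proof.
move=> Tup TA Tf.
have thT : theory context_le T.
  by split=> // a b /context_le_entails; apply: Tup.
have [T' [bT' [T'up _] sTT' T'f]] := prime_theory context_le context_le_BD
  context_le_trans context_le_glb context_le_lub _ f thT Tf.
by exists T'.
Qed.

(** A counterexample contains a and omits b, so the empty and the full theory need not lie in
    [C]. *)
Lemma context_complete1 (C : set (set formula)) a b :
    (forall T, bivaluation T -> (forall c d, context_le c d -> T c -> T d) ->
       T !=set0 -> ~ T b -> C T) ->
    (forall T, bivaluation T -> C T -> T a -> T b) ->
  L [set a] b.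
Proof.
move=> CP Cab; apply: context_le_entails; apply: contrapT => nab.
have thT : theory context_le [set c | context_le a c].
  split=> [c d cd ac|c d]; first exact: context_le_trans cd.
  exact: context_le_glb.
have [T [bT [Tup _] sT Tb]] := prime_theory context_le context_le_BD
  context_le_trans context_le_glb context_le_lub _ b thT nab.
have Ta : T a by apply: sT; apply: context_le_BD; bival.
exact: Tb (Cab T bT (CP T bT Tup (ex_intro _ a Ta) Tb) Ta).
Qed.

(* Once the variables are replaced by literals according to their values under
   T, c lies below every formula of T and d above every formula outside T. *)
Lemma refutation_collapse (T : set formula) (s : nat -> formula) c d G f :
    bivaluation T ->
    (forall i, T (Var i) -> BD_inf [set c] (s i)) ->
    (forall i, T (Neg (Var i)) -> BD_inf [set c] (Neg (s i))) ->
    (forall i, ~ T (Var i) -> BD_inf [set s i] d) ->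
    (forall i, ~ T (Neg (Var i)) -> BD_inf [set Neg (s i)] d) ->
  L G f -> G `<=` T -> ~ T f -> L [set c] d.
Proof.
move=> bT cT cTN dT dTN LGf sGT Tf.
have le1 a b U : BD_inf [set a] b -> bivaluation U -> U a -> U b.
  by move=> BDab bU Ua; apply: (BD_sound _ _ _ bU BDab) => _ ->.
apply: (@entails1_trans _ _ (subst s f)); last first.
  (* If U omits d, its preimage under the substitution lies inside T and omits f; if U contains c,
     the preimage includes T and hence G. *)
  apply: BDL; apply: BD_complete => U bU Uf; apply: contrapT => Ud; apply: Tf.
  apply: (bivaluation_le _ _ (bivaluation_subst _ _ (subst_hom s) bU) bT) Uf => i.
    move=> Ui; apply: contrapT => /dT BDi; exact: Ud (le1 _ _ _ BDi bU Ui).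
  move=> Ui; apply: contrapT => /dTN BDi; exact: Ud (le1 _ _ _ BDi bU Ui).
apply: (@logic_cut L _ (subst s @` G)) => [_ [g Gg <-]|].
  apply: BDL; apply: BD_complete => U bU Uc.
  apply: (bivaluation_le _ _ bT (bivaluation_subst _ _ (subst_hom s) bU))
    (sGT _ Gg) => i.
    by move=> /cT BDi; exact: le1 BDi bU Uc.
  by move=> /cTN BDi; exact: le1 BDi bU Uc.
by apply: logic_mono (logic_subst (subst_hom s) LGf) => a; right.
Qed.
End Context.

(** * Collapsing a refuted entailment to a few variables *)

Definition no_glut (T : set formula) := forall a, ~ (T a /\ T (Neg a)).
Definition no_gap (T : set formula) := forall a, T a \/ T (Neg a).

Local Notation x := (Var 0).
Local Notation y := (Var 1).
Local Notation z := (Var 2).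

(* Gluts are sent to x, true variables to y, false ones to Neg y, gaps to z. *)
Definition value_subst (T : set formula) (i : nat) : formula :=
  if `[< T (Var i) >] then
    if `[< T (Neg (Var i)) >] then x else y
  else if `[< T (Neg (Var i)) >] then Neg y else z.

Section Collapse.
Variables (L : logic) (G T : set formula) (f : formula).
Hypotheses (BDL : logic_le BD_inf L) (bT : bivaluation T).
Hypotheses (LGf : L G f) (sGT : G `<=` T) (Tf : ~ T f).

Ltac by_values gl gp := let i := fresh "i" in move=> i; move: (gl (Var i)) (gp (Var i));
  rewrite /value_subst; case: asboolP; case: asboolP; move=> *;
  try tauto; bival.

Lemma collapse :
  L [set And y (And x (Neg x))] (Or (Neg y) (Or z (Neg z))).
Proof.
(* [triv] fills the places of the absent glut and gap hypotheses in [by_values]. *)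
have triv : formula -> True by [].
by apply: (refutation_collapse _ BDL T (value_subst T) _ _ G f) => //;
  by_values triv triv.
Qed.

Lemma collapse_no_gap : no_gap T -> L [set And y (And x (Neg x))] (Neg y).
Proof.
have triv : formula -> True by [].
by move=> gp; apply: (refutation_collapse _ BDL T (value_subst T) _ _ G f) => //;
  by_values triv gp.
Qed.

Lemma collapse_no_glut : no_glut T -> L [set y] (Or (Neg y) (Or z (Neg z))).
Proof.
have triv : formula -> True by [].
by move=> gl; apply: (refutation_collapse _ BDL T (value_subst T) _ _ G f) => //;
  by_values gl triv.
Qed.

Lemma collapse_classical : no_glut T -> no_gap T -> L [set y] (Neg y).
Proof.
by move=> gl gp; apply: (refutation_collapse _ BDL T (value_subst T) _ _ G f) => //;
  by_values gl gp.
Qed.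
End Collapse.

(** * Logics of classes of bivaluations *)

Section BivalLogic.
Variable C : set (set formula).
Hypothesis C_subst : forall (T : set formula) (s : Fm -> Fm),
  hom s -> C T -> C [set a | T (s a)].

Definition bival_ent (G : set formula) f : Prop :=
  forall T, bivaluation T -> C T -> G `<=` T -> T f.

Definition bival_logic : logic.
Proof.
refine (@Logic bival_ent _ _ _ _).
- by move=> G f Gf T _ _; apply.
- by move=> G D f sGD Gf T bT CT sDT; apply: Gf => // a /sGD /sDT.
- move=> G D f GD GDf T bT CT sGT; apply: GDf => // a [/sGT//|Da].
  exact: GD.
- move=> s G f hs Gf T bT CT sGT.
  apply: (Gf _ (bivaluation_subst _ _ hs bT) (C_subst _ _ hs CT)) => a Ga.
  by apply: sGT; exists a.
Defined.

Lemma BD_le_bival_logic : logic_le BD_inf bival_logic.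
Proof. by move=> G f BDGf T bT _; apply: BD_sound BDGf. Qed.

Lemma bival_logic_adjunction : bival_logic adjunction.1 adjunction.2.
Proof.
move=> T bT _ /= sT; rewrite (bivalA _ bT).
by split; apply: sT; [left|right].
Qed.
End BivalLogic.

Lemma BD_1_sound G f T : bivaluation T -> BD_1 G f -> G `<=` T -> T f.
Proof.
pose M := bival_logic setT (fun _ _ _ _ => I).
suff BDM : logic_le BD_1 M by move=> bT /BDM; apply.
apply: extension_smallest; split=> [|_ ->]; first exact: BD_le_bival_logic.
exact: bival_logic_adjunction.
Qed.

(** * Prime theories for the [KO] and [CL] logics *)

Definition kleene_theory (T : set formula) : Prop := no_glut T \/ no_gap T.

Lemma no_glut_subst (T : set formula) (s : Fm -> Fm) :
  hom s -> no_glut T -> no_glut [set a | T (s a)].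
Proof. by move=> [_ _ sN] gl a; move: (gl (s a)); rewrite -[Neg _]sN. Qed.

Lemma no_gap_subst (T : set formula) (s : Fm -> Fm) :
  hom s -> no_gap T -> no_gap [set a | T (s a)].
Proof. by move=> [_ _ sN] gp a; move: (gp (s a)); rewrite -[Neg _]sN. Qed.

Lemma KO_1_sound G f T :
  bivaluation T -> kleene_theory T -> KO_1 G f -> G `<=` T -> T f.
Proof.
have Csub (U : set formula) (s : Fm -> Fm) : hom s -> kleene_theory U ->
    kleene_theory [set a | U (s a)].
  move=> hs [gl|gp]; [left|right]; first exact: no_glut_subst.
  exact: no_gap_subst.
pose M := bival_logic _ Csub.
suff KOM : logic_le KO_1 M by move=> bT KT /KOM; apply.
apply: extension_smallest; split=> [|_ ->]; last exact: bival_logic_adjunction.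
apply: extension_smallest; split=> [|_ ->]; first exact: BD_le_bival_logic.
move=> U bU KU /= /(_ _ erefl).
rewrite !(bivalO _ bU, bivalA _ bU).
by case: KU => [/(_ x)|/(_ y)]; tauto.
Qed.

Lemma CL_1_sound G f T :
  bivaluation T -> no_glut T -> no_gap T -> CL_1 G f -> G `<=` T -> T f.
Proof.
have Csub (U : set formula) (s : Fm -> Fm) : hom s -> no_glut U /\ no_gap U ->
    no_glut [set a | U (s a)] /\ no_gap [set a | U (s a)].
  by move=> hs [gl gp]; split; [exact: no_glut_subst|exact: no_gap_subst].
pose M := bival_logic _ Csub.
suff CLM : logic_le CL_1 M by move=> bT gl gp /CLM; apply.
apply: extension_smallest; split=> [|_ ->]; last exact: bival_logic_adjunction.
apply: extension_smallest; split=> [|_ [[]|] ->]; first exact: BD_le_bival_logic.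
- by move=> U bU [_ gp] _ /=; rewrite (bivalO _ bU); apply: gp.
- move=> U bU [_ /(_ y)] + /= /(_ _ erefl).
  by rewrite !(bivalO _ bU, bivalA _ bU); tauto.
- move=> U bU [/(_ x) + _] /= /(_ _ erefl).
  by rewrite !(bivalO _ bU, bivalA _ bU); tauto.
Qed.

Lemma BD_le_KO : logic_le BD_inf KO_inf.
Proof. by have [] := extension_contains BD_inf [set KO_rule]. Qed.

Lemma BD_le_CL : logic_le BD_inf CL_inf.
Proof.
by have [] := extension_contains BD_inf [set lem_rule; lem_weakening_rule; K_rule].
Qed.

Lemma KO_inf_context_le a b :
  context_le KO_inf (And a (Neg a)) (Or b (Neg b)).
Proof.
have [_ /(_ _ erefl) KO] := extension_contains BD_inf [set KO_rule].
by move=> c d; apply: (entails1_subst KO_inf (assign a b c d) _ _ KO).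
Qed.

(** Weakening is applied to the whole premise [Or (And a c) d]; distributivity then moves the
    excluded middle inside. *)
Lemma CL_inf_context_le_top a b : context_le CL_inf a (Or b (Neg b)).
Proof.
have [_ rules] :=
  extension_contains BD_inf [set lem_rule; lem_weakening_rule; K_rule].
have wk := rules _ (or_introl (or_intror erefl)).
move=> c d; apply: entails1_trans
  (entails1_subst CL_inf (assign (Or (And a c) d) b x x) _ _ wk) _.
by apply: BD_le_CL; rewrite /=; bival.
Qed.

Lemma CL_inf_context_le_bot a b : context_le CL_inf (And a (Neg a)) b.
Proof.
have [_ rules] :=
  extension_contains BD_inf [set lem_rule; lem_weakening_rule; K_rule].
have K := rules _ (or_intror erefl).
move=> c d; apply: (@entails1_trans _ _ (Or (And a (Neg a)) d)).
  by apply: BD_le_CL; bival.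
apply: entails1_trans (entails1_subst CL_inf (assign a d x x) _ _ K) _.
by apply: BD_le_CL; rewrite /=; bival.
Qed.

(** One glut forces every excluded middle into T, which leaves no gap. *)
Lemma KO_closed_kleene (T : set formula) : bivaluation T ->
  (forall c d, context_le KO_inf c d -> T c -> T d) -> kleene_theory T.
Proof.
move=> bT Tup; have [gl|/existsNP[a /contrapT Ta]] := pselect (no_glut T).
  by left.
right=> b; rewrite -(bivalO _ bT); apply: Tup (KO_inf_context_le a b) _.
by rewrite (bivalA _ bT).
Qed.

Lemma CL_closed_classical (T : set formula) f : bivaluation T ->
    (forall c d, context_le CL_inf c d -> T c -> T d) -> T !=set0 -> ~ T f ->
  no_glut T /\ no_gap T.
Proof.
move=> bT Tup [t Tt] Tf; split=> a; last first.
  by rewrite -(bivalO _ bT); apply: Tup (CL_inf_context_le_top t a) Tt.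
rewrite -(bivalA _ bT) => Ta; apply: Tf.
exact: Tup (CL_inf_context_le_bot a f) Ta.
Qed.

Lemma selfextensional_bival (L : logic) (C : set (set formula)) :
    (forall T, C T -> C (dual_theory T)) ->
    (forall a b, L [set a] b <->
       forall T, bivaluation T -> C T -> T a -> T b) ->
  selfextensional L.
Proof.
move=> Cdual LE.
have eqE a b : interderivable L a b <->
    forall T, bivaluation T -> C T -> (T a <-> T b).
  rewrite /interderivable !LE; split=> [[ab ba] T bT CT|ab].
    by split; [apply: ab|apply: ba].
  by split=> T bT CT; have [] := ab T bT CT.
split; split.
- by move=> a; apply/eqE.
- by move=> a b /eqE ab; apply/eqE => T bT CT; rewrite ab.
- by move=> a b c /eqE ab /eqE bc; apply/eqE => T bT CT; rewrite ab // bc.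
- move=> a a' b b' /eqE aa' /eqE bb'; apply/eqE => T bT CT /=.
  by rewrite !(bivalA _ bT); move: (aa' T bT CT) (bb' T bT CT); tauto.
- move=> a a' b b' /eqE aa' /eqE bb'; apply/eqE => T bT CT /=.
  by rewrite !(bivalO _ bT); move: (aa' T bT CT) (bb' T bT CT); tauto.
- move=> a a' /eqE aa'; apply/eqE => T bT CT /=.
  (* [Neg a] lies in T exactly when a lies outside the dual theory, where a and a' agree as well. *)
  have [a1 a2] := aa' _ (bivaluation_dual _ bT) (Cdual _ CT).
  by split=> Ta; apply: contrapT => Ta'; [case: (a2 Ta')|case: (a1 Ta')].
Qed.

Lemma no_glut_dual (T : set formula) :
  bivaluation T -> no_glut T -> no_gap (dual_theory T).
Proof.
move=> bT gl a; rewrite /dual_theory /= (bivalNN _ bT).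
by move: (gl a) => /not_andP[]; [right|left].
Qed.

Lemma no_gap_dual (T : set formula) :
  bivaluation T -> no_gap T -> no_glut (dual_theory T).
Proof.
move=> bT gp a; rewrite /dual_theory /= (bivalNN _ bT).
by move: (gp a); tauto.
Qed.

Lemma selfextensional_BD (L : logic) :
  interval BD_inf BD_1 L -> selfextensional L.
Proof.
move=> [BDL LBD]; apply: (selfextensional_bival _ setT) => // a b.
split=> [Lab T bT _ Ta|ab].
  by apply: (BD_1_sound _ _ _ bT (LBD _ _ Lab)) => _ ->.
by apply/BDL/BD_complete => T bT; apply: ab.
Qed.

Lemma selfextensional_KO (L : logic) :
  interval KO_inf KO_1 L -> selfextensional L.
Proof.
move=> [KOL LKO].
apply: (selfextensional_bival _ [set T | bivaluation T /\ kleene_theory T]).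
  move=> T [bT KT]; split; first exact: bivaluation_dual.
  by case: KT => [/no_glut_dual|/no_gap_dual] dT; [right|left]; apply: dT.
move=> a b; split=> [Lab T bT [_ KT] Ta|ab].
  by apply: (KO_1_sound _ _ _ bT KT (LKO _ _ Lab)) => _ ->.
apply: KOL; apply: (context_complete1 _ BD_le_KO _ _ _ _ ab) => T bT Tup _ _.
by split=> //; exact: KO_closed_kleene.
Qed.

Lemma selfextensional_CL (L : logic) :
  interval (logic_meet CL_inf TRIVm) CL_1 L -> selfextensional L.
Proof.
move=> [CLL LCL].
apply: (selfextensional_bival _
  [set T | [/\ bivaluation T, no_glut T & no_gap T]]).
  move=> T [bT gl gp].
  by split; [exact: bivaluation_dual|exact: no_gap_dual|exact: no_glut_dual].
move=> a b; split=> [Lab T bT [_ gl gp] Ta|ab].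
  by apply: (CL_1_sound _ _ _ bT gl gp (LCL _ _ Lab)) => _ ->.
(* With a single premise, the meet with [TRIVm] costs nothing. *)
apply: CLL; split; last by exists a.
apply: (context_complete1 _ BD_le_CL _ _ _ _ ab) => T bT Tup T0 Tb.
by have [] := CL_closed_classical _ _ bT Tup T0 Tb.
Qed.

Lemma entails_adjunction (L : logic) G a b :
  L adjunction.1 adjunction.2 -> L G a -> L G b -> L G (And a b).
Proof.
move=> adj La Lb; apply: (@logic_cut L _ [set a; b]).
  by move=> _ [->|->].
apply: logic_mono (logic_subst (subst_hom (assign a b a a)) adj).
by move=> _ [_ [->|->] <-]; right; [left|right].
Qed.

(** Adjunction makes the consequences of G closed under conjunction, so they extend to a prime
    theory omitting f. *)
Lemma adjunction_extension_refutation (L : logic) G f : logic_le BD_inf L ->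
    ~ extension L [set adjunction] G f ->
  exists T, [/\ bivaluation T, extension L [set adjunction] G `<=` T, ~ T f &
    forall a b, context_le L a b -> T a -> T b].
Proof.
move=> BDL nGf.
have [LL1 /(_ _ erefl) adj] := extension_contains L [set adjunction].
apply: (context_prime_theory L BDL _ f) nGf => [a b Lab La|a b].
  by apply: entails_cut1 La _; apply: LL1.
exact: entails_adjunction.
Qed.

(** * Upper bounds *)

Section UpperBound.
Variable L : logic.
Hypothesis BDL : logic_le BD_inf L.

Lemma le_BD_1 : ~ L [set And x (Neg x)] (Or y (Neg y)) -> logic_le L BD_1.
Proof.
move=> nKO G f LGf; apply: contrapT => nGf.
have [T [bT sT Tf _]] := adjunction_extension_refutation _ _ _
  (fun _ _ => id) nGf.
have sGT : G `<=` T by move=> a Ga; apply: sT; exact: logic_refl.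
have := collapse _ _ _ _ BDL bT LGf sGT Tf.
(* The surplus premise [Or x y] is absorbed by x, and the surplus disjunct [Neg (Or x y)] by
   [Neg y]. *)
move=> /(entails1_subst _ (assign x (Or x y) y x)) /= Lc; apply: nKO.
apply: entails1_trans (entails1_trans _ _ _ _ _ Lc) _; apply: BDL; bival.
Qed.

Hypothesis L_neg : forall a b, L [set a] b -> L [set Neg b] (Neg a).

Lemma le_KO_1 : ~ L [set And x (Neg x)] y -> logic_le L KO_1.
Proof.
move=> nK G f LGf; apply: contrapT => nGf.
have [T [bT sT Tf Tup]] := adjunction_extension_refutation _ _ _ BD_le_KO nGf.
have sGT : G `<=` T by move=> a Ga; apply: sT; exact: logic_refl.
have : L [set And y (And x (Neg x))] (Neg y).
  have [gl|gp] := KO_closed_kleene _ bT Tup.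
    (* Contraposition turns the excluded middle in the conclusion into a contradiction in the
       premise, which matches the gapless case. *)
    have /L_neg := collapse_no_glut _ _ _ _ BDL bT LGf sGT Tf gl.
    move=> /(entails1_subst _ (assign x y x x)) /= Lc.
    by apply: entails1_trans Lc; apply: BDL; bival.
  exact: collapse_no_gap LGf sGT Tf gp.
(* The premise [Or x (Neg y)] follows from x, while its negation entails y. *)
move=> /(entails1_subst _ (assign x (Or x (Neg y)) x x)) /= Lc; apply: nK.
apply: entails1_trans (entails1_trans _ _ _ _ _ Lc) _; apply: BDL; bival.
Qed.

Lemma le_CL_1 : ~ L [set x] y -> logic_le L CL_1.
Proof.
move=> nT G f LGf; apply: contrapT => nGf.
have [T [bT sT Tf Tup]] := adjunction_extension_refutation _ _ _ BD_le_CL nGf.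
have sGT : G `<=` T by move=> a Ga; apply: sT; exact: logic_refl.
(* Even for empty G, the theorems of [CL_inf] make T nonempty. *)
have T0 : T !=set0.
  exists (Or x (Neg x)); apply: sT.
  have [LL1 _] := extension_contains CL_inf [set adjunction]; apply: LL1.
  have [_ rules] :=
    extension_contains BD_inf [set lem_rule; lem_weakening_rule; K_rule].
  by apply: logic_mono (rules _ (or_introl (or_introl erefl))).
have [gl gp] := CL_closed_classical _ _ bT Tup T0 Tf.
have := collapse_classical _ _ _ _ BDL bT LGf sGT Tf gl gp.
move=> /(entails1_subst _ (assign x (Or x (Neg y)) x x)) /= Lc; apply: nT.
apply: entails1_trans (entails1_trans _ _ _ _ _ Lc) _; apply: BDL; bival.
Qed.
End UpperBound.

(** * Selfextensional extensions *)

Section Selfextensional.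
Variable L : logic.
Hypothesis BDL : logic_le BD_inf L.

(** The common yield of weak CP (meet form) and weak PCP (join form). *)
Definition le_by_equivalence : Prop := forall a b, L [set a] b ->
  interderivable L a (And a b) \/ interderivable L (Or a b) b.

Lemma weak_le_by_equivalence : weak_CP L \/ weak_PCP L -> le_by_equivalence.
Proof.
move=> [CP|PCP] a b Lab.
  by left; split; [apply: CP => //; exact: logic_refl|apply: BDL; bival].
by right; split; [apply: PCP => //; exact: logic_refl|apply: BDL; bival].
Qed.

Hypothesis leE : le_by_equivalence.
Hypothesis L_self : selfextensional L.

(** Negation carries an equivalence of a with [And a b] to one of [Neg a] with [Or (Neg a) (Neg b)],
    which [Neg b] entails; the join form is dual. *)
Lemma selfextensional_neg a b : L [set a] b -> L [set Neg b] (Neg a).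
Proof.
have [_ [_ _ cN]] := L_self; move=> /leE[] /cN[/= L1 L2].
  by apply: entails1_trans L2; apply: BDL; bival.
by apply: entails1_trans L2 _; apply: BDL; bival.
Qed.

(** Congruence places the equivalence from [leE] in any context, so entailment and [context_le]
    coincide here. *)
Lemma selfextensional_context a b : L [set a] b -> context_le L a b.
Proof.
have [[eqv _ _] [cA cO _]] := L_self.
have cx p q c d : interderivable L p q ->
    interderivable L (Or (And p c) d) (Or (And q c) d).
  by move=> pq; apply: (cO _ _ _ _ (cA _ _ _ _ pq (eqv c)) (eqv d)).
move=> /leE[] eab c d; have [L1 L2] := cx _ _ c d eab.
  by apply: entails1_trans L1 _; apply: BDL; bival.
by apply: entails1_trans L1; apply: BDL; bival.
Qed.

Lemma KO_le : L [set And x (Neg x)] (Or y (Neg y)) -> logic_le KO_inf L.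
Proof.
move=> /selfextensional_context LKO.
by apply: extension_smallest; split=> // _ ->; apply: LKO.
Qed.

(* Adding every excluded middle as a premise turns L into an extension of
   CL_inf without changing its consequences from nonempty premises. *)
Lemma CL_le : L [set And x (Neg x)] y -> logic_le (logic_meet CL_inf TRIVm) L.
Proof.
move=> LK.
(* Contraposing explosion at [Neg a] gives the excluded middle for b from a, by De Morgan and double
   negation. *)
have Ltop a b : L [set a] (Or b (Neg b)).
  have := selfextensional_neg _ _ LK.
  move=> /(entails1_subst _ (assign b (Neg a) x x)) /= Lc.
  apply: entails1_trans (entails1_trans _ _ _ _ _ Lc) _; apply: BDL; bival.
pose E : set formula := [set a | exists b, a = Or b (Neg b)].
have [M ME] : exists M : logic, forall G f, M G f = L (G `|` E) f.
  unshelve eexists (@Logic (fun G f => L (G `|` E) f) _ _ _ _) => //.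
  - by move=> G f Gf; apply: logic_refl; left.
  - by move=> G D f sGD; apply: logic_mono => a [/sGD|]; [left|right].
  - move=> G D f GD GDf; apply: logic_cut GD _.
    by apply: logic_mono GDf => a [[]|]; [left; left|right|left; right].
  - move=> s G f hs /(logic_subst hs); apply: logic_mono.
    have [_ sO sN] := hs.
    move=> _ [a [Ga|[b ->]] <-]; [by left; exists a|right].
    by exists (s b); rewrite -[Neg (s b)]sN -[RHS]sO.
have CLM : logic_le CL_inf M.
  apply: extension_smallest; split=> [G f BDGf|_ [[]|] ->]; rewrite ME /=.
  - by apply: logic_mono (BDL _ _ BDGf) => a; left.
  - by apply: logic_refl; right; exists x.
  - apply: (@logic_mono L [set x]); first by move=> a; left.
    apply: context_le_entails => //; apply: context_le_glb => //.
      by apply: context_le_BD => //; bival.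
    exact: selfextensional_context.
  - apply: (@logic_mono L [set Or (And x (Neg x)) y]); first by move=> a; left.
    apply: context_le_entails => //; apply: context_le_lub => //.
      exact: selfextensional_context.
    by apply: context_le_BD => //; bival.
move=> G f [/CLM + [g Gg]]; rewrite ME; apply: logic_cut => _ [b ->].
by apply: logic_mono (Ltop g b) => _ ->.
Qed.

Lemma trivial_entailment :
  L [set x] y -> logic_eq L TRIVm \/ logic_eq L TRIV.
Proof.
move=> Lxy.
have Lab a b : L [set a] b by exact: (entails1_subst L (assign a b a a) _ _ Lxy).
have L0 G f : G !=set0 -> L G f.
  by move=> [g Gg]; apply: logic_mono (Lab g f) => _ ->.
(* Having a theorem is what separates [TRIV] from [TRIVm]. *)
have [[a La]|nL] := pselect (exists a, L set0 a).
  right=> G f; split=> // _; apply: (@entails_cut1 _ _ a) => //.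
  exact: logic_mono La.
left=> G f; split=> [LGf|/L0//]; apply: contrapT => /set0P /negP.
by rewrite negbK => /eqP G0; apply: nL; exists f; rewrite -G0.
Qed.

Lemma selfextensional_classification :
  interval BD_inf BD_1 L \/ interval KO_inf KO_1 L \/
  interval (logic_meet CL_inf TRIVm) CL_1 L \/
  (logic_eq L TRIVm \/ logic_eq L TRIV).
Proof.
have [KO|nKO] := pselect (L [set And x (Neg x)] (Or y (Neg y))); last first.
  by left; split=> //; exact: le_BD_1.
right; have [K|nK] := pselect (L [set And x (Neg x)] y); last first.
  left; split; [exact: KO_le|apply: le_KO_1 => //; exact: selfextensional_neg].
right; have [tr|ntr] := pselect (L [set x] y).
  by right; exact: trivial_entailment.
by left; split; [exact: CL_le|exact: le_CL_1].
Qed.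
End Selfextensional.

(** * Trivial logics and disjointness of the intervals *)

Lemma selfextensional_total (L : logic) :
  (forall a b, L [set a] b) -> selfextensional L.
Proof. by move=> Lab; split; split. Qed.

(* eval t f true a says that a is told true, eval t f false a that it is told
   false, when t and f list the variables told true and told false. *)
Fixpoint eval (t f : pred nat) (b : bool) (a : formula) : bool :=
  match a with
  | Var i => if b then t i else f i
  | And c d => if b then eval t f b c && eval t f b d
               else eval t f b c || eval t f b d
  | Or c d => if b then eval t f b c || eval t f b d
              else eval t f b c && eval t f b d
  | Neg c => eval t f (~~ b) c
  end.

Lemma bivaluation_eval t f : bivaluation (eval t f true).
Proof.
by split=> *; apply/propext => //=; split; (move/andP || move/orP || move=> ?);
  (apply/andP || apply/orP || idtac).
Qed.

Lemma KO_rule_not_BD_1 : ~ BD_1 KO_rule.1 KO_rule.2.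
Proof.
(* Here x is a glut, y a gap, z only true and u only false. *)
move=> /(BD_1_sound _ _ (eval (mem [:: 0; 2]) (mem [:: 0; 3]) true)).
by move=> /(_ (bivaluation_eval _ _)) H; suff : false by []; apply: H => _ ->.
Qed.

Lemma K_rule_not_KO_1 : ~ KO_1 K_rule.1 K_rule.2.
Proof.
(* Here x is a glut and all other variables are only false; since every variable is told false, no
   gap arises. *)
set T : set formula := eval (pred1 0) predT true.
have gp : no_gap T.
  move=> a; apply/orP; rewrite /=.
  elim: a => /= [i|a IHa b IHb|a IHa b IHb|a]; last by rewrite orbC.
  - by rewrite orbT.
  - case: (eval _ _ true a) IHa => /= [_|->]; last by [].
    by case: (eval _ _ true b) IHb => /= [//|->]; rewrite orbT.
  - case: (eval _ _ false a) IHa => /=; last by rewrite orbF => ->.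
    by case: (eval _ _ false b) IHb; rewrite ?orbT ?orbF // => ->; rewrite orbT.
move=> /(KO_1_sound _ _ T (bivaluation_eval _ _) (or_intror gp)) H.
by suff : false by []; apply: H => _ ->.
Qed.

Lemma BD_1_le_KO_1 : logic_le BD_1 KO_1.
Proof.
have [KO1 adj] := extension_contains KO_inf [set adjunction].
apply: extension_smallest; split=> // G f /BD_le_KO; exact: KO1.
Qed.

Lemma K_rule_CL_meet : logic_meet CL_inf TRIVm K_rule.1 K_rule.2.
Proof.
split; last by eexists.
have [_ rules] :=
  extension_contains BD_inf [set lem_rule; lem_weakening_rule; K_rule].
exact: rules (or_intror erefl).
Qed.

Theorem mainTheorem20 :
  (forall L : logic, logic_le BD_inf L -> weak_CP L \/ weak_PCP L ->
     (selfextensional L <->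
        interval BD_inf BD_1 L \/
        interval KO_inf KO_1 L \/
        interval (logic_meet CL_inf TRIVm) CL_1 L \/
        (logic_eq L TRIVm \/ logic_eq L TRIV))) /\
  [/\ interval BD_inf BD_1 `&` interval KO_inf KO_1 = set0,
      interval BD_inf BD_1 `&` interval (logic_meet CL_inf TRIVm) CL_1 = set0
    & interval KO_inf KO_1 `&` interval (logic_meet CL_inf TRIVm) CL_1 = set0].
Proof.
split.
  move=> L BDL /(weak_le_by_equivalence _ BDL) leE.
  split=> [|[|[|[|[LE|LE]]]]].
  - exact: selfextensional_classification.
  - exact: selfextensional_BD.
  - exact: selfextensional_KO.
  - exact: selfextensional_CL.
  - by apply: selfextensional_total => a b; apply/LE; exists a.
  - by apply: selfextensional_total => a b; apply/LE.
(* In each case a rule holds at the bottom of the second interval but fails at the top of the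
   first. *)
split; rewrite -subset0 => L [].
- move=> [_ LBD] [KOL _]; apply/KO_rule_not_BD_1/LBD/KOL.
  by have [_] := extension_contains BD_inf [set KO_rule]; apply.
- move=> [_ LBD] [CLL _]; apply/K_rule_not_KO_1/BD_1_le_KO_1/LBD/CLL.
  exact: K_rule_CL_meet.
- move=> [_ LKO] [CLL _]; apply/K_rule_not_KO_1/LKO/CLL.
  exact: K_rule_CL_meet.
Qed.
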